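(* Let $\mathbb{C}$ be a regular category, let $\mathcal{N}$ be an ideal in $\mathbb{C}$ such that every morphism of $\mathbb{C}$ has an $\mathcal{N}$-kernel, and let $\mathbb{P}$ be a projective cover of $\mathbb{C}$. Let $\mathcal{N}_{\mathbb{P}}$ be the ideal of $\mathbb{P}$ consisting of those morphisms of $\mathbb{P}$ which belong to $\mathcal{N}$. Then: (1) if $(\mathbb{C},\mathcal{N})$ is star-regular, then every reflexive graph in $\mathbb{P}$ satisfies $(\ast\pi_0)$ with respect to $(\mathbb{P},\mathcal{N}_{\mathbb{P}})$; (2) the converse of (1) also holds, provided $\mathbb{C}$ is a regular completion of $\mathbb{P}$.
   Context: An ideal in a category $\mathbb{X}$ is a class $\mathcal{M}$ of morphisms such that whenever $fgh$ is a composite of three morphisms with $g\in\mathcal{M}$, then $fgh\in\mathcal{M}$. A pair $(\mathbb{X},\mathcal{M})$ with $\mathcal{M}$ an ideal of $\mathbb{X}$ is called a multi-pointed category. An $\mathcal{M}$-kernel of $f:X\to Y$ is a morphism $k:K\to X$ with $fk\in\mathcal{M}$ such that for every $k':K'\to X$ with $fk'\in\mathcal{M}$ there is a unique $u:K'\to K$ with $k'=ku$; a weak $\mathcal{M}$-kernel is defined in the same way but without requiring uniqueness of $u$. The $\mathcal{M}$-star (respectively, a weak $\mathcal{M}$-star) of an ordered pair $(f_1,f_2)$ of parallel morphisms is the pair $(f_1k,f_2k)$ where $k$ is an $\mathcal{M}$-kernel (respectively, a weak $\mathcal{M}$-kernel) of $f_1$. The kernel star of a morphism is the $\mathcal{M}$-star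 of its kernel pair. Condition $(\ast\pi_0)$, with respect to $(\mathbb{X},\mathcal{M})$, on an ordered pair $(f_1,f_2)$ of parallel morphisms $f_1,f_2:X\to Y$ in $\mathbb{X}$: for a weak $\mathcal{M}$-star $(f_1k,f_2k)$ of $(f_1,f_2)$ in $\mathbb{X}$ and for any morphism $g:Y\to Z$ in $\mathbb{X}$, one has $gf_1k=gf_2k \Leftrightarrow gf_1=gf_2$. (When a weak $\mathcal{M}$-star exists, requiring this for one weak $\mathcal{M}$-star is equivalent to requiring it for all of them.) A reflexive graph consists of morphisms $d,c:G_1\to G_0$ and $e:G_0\to G_1$ with $de=ce=1_{G_0}$; it satisfies $(\ast\pi_0)$ if the ordered pair $(d,c)$ does. A star-regular category is a pair $(\mathbb{C},\mathcal{N})$ where $\mathbb{C}$ is a regular category, $\mathcal{N}$ is an ideal in $\mathbb{C}$ such that every morphism has an $\mathcal{N}$-kernel, and every regular epimorphism in $\mathbb{C}$ is a coequalizer of its kernel star. A projective cover of a regular category $\mathbb{C}$ is a full subcategory $\mathbb{P}$ of $\mathbb{C}$ such that every object $P$ of $\mathbb{P}$ is (regular) projective in $\mathbb{C}$, i.e. $\mathsf{hom}(P,-):\mathbb{C}\to\mathbf{Set}$ preserves regular epimorphisms, and for every object $C$ of $\mathbb{C}$ there is a regular epimorphism $P\to C$ with $P\in\mathbb{P}$. A regular category $\mathbb{C}$ is a regular completion of a category $\mathbb{P}$ with weak finite limits if (up to equivalence) $\mathbb{P}$ is a projective cover of $\mathbb{C}$ and for every object $C$ of $\mathbb{C}$ there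 is a monomorphism $C\to\prod_{i=1}^nP_i$ into a finite product (in $\mathbb{C}$) of objects $P_i$ of $\mathbb{P}$. *)

(* Defs.v *)
From mathcomp Require Import all_boot.

Set Implicit Arguments.
Unset Strict Implicit.
Unset Printing Implicit Defensive.

Declare Scope cat_scope.
Delimit Scope cat_scope with cat.

Record category := Category {
  Obj :> Type;
  Hom : Obj -> Obj -> Type;
  idm : forall X, Hom X X;
  comp : forall X Y Z, Hom Y Z -> Hom X Y -> Hom X Z;
  comp_idl : forall X Y (f : Hom X Y), comp (idm Y) f = f;
  comp_idr : forall X Y (f : Hom X Y), comp f (idm X) = f;
  comp_assoc : forall W X Y Z (h : Hom W X) (g : Hom X Y) (f : Hom Y Z),
    comp f (comp g h) = comp (comp f g) h
}.

Arguments Hom {c} X Y.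
Arguments idm {c} X.
Arguments comp {c X Y Z} g f.

Notation "g ∘ f" := (comp g f) (at level 40, left associativity) : cat_scope.
Local Open Scope cat_scope.

(* The category of sets is the category of types in the universe of hom-sets. *)
Definition SET : category :=
  @Category Type (fun X Y => X -> Y) (fun X x => x)
    (fun X Y Z g f x => g (f x))
    (fun X Y f => erefl) (fun X Y f => erefl) (fun W X Y Z h g f => erefl).

Definition full_subcategory (C : category) (P : C -> Prop) : category :=
  @Category {X : C | P X} (fun X Y => Hom (sval X) (sval Y))
    (fun X => idm (sval X)) (fun X Y Z g f => g ∘ f)
    (fun X Y f => comp_idl f) (fun X Y f => comp_idr f)
    (fun W X Y Z h g f => comp_assoc h g f).

(* A finite diagram is indexed by a finite directed multigraph: a
   diagram on a finite category is a particular case, its cones being the cones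
   on the underlying graph. *)

Record finite_diagram (C : category) := FiniteDiagram {
  vertex : finType;
  edge : finType;
  src : edge -> vertex;
  tgt : edge -> vertex;
  dob : vertex -> C;
  dmor : forall e, Hom (dob (src e)) (dob (tgt e))
}.

Arguments src {C D} e : rename.
Arguments tgt {C D} e : rename.
Arguments dob {C} D v : rename.
Arguments dmor {C D} e : rename.

Definition is_cone (C : category) (D : finite_diagram C) (X : C)
    (p : forall v, Hom X (dob D v)) : Prop :=
  forall e : edge D, dmor e ∘ p (src e) = p (tgt e).

Definition is_limit (C : category) (D : finite_diagram C) (L : C)
    (p : forall v, Hom L (dob D v)) : Prop :=
  is_cone p /\
  forall (X : C) (q : forall v, Hom X (dob D v)), is_cone q ->
    exists! u : Hom X L, forall v, p v ∘ u = q v.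

Definition is_weak_limit (C : category) (D : finite_diagram C) (L : C)
    (p : forall v, Hom L (dob D v)) : Prop :=
  is_cone p /\
  forall (X : C) (q : forall v, Hom X (dob D v)), is_cone q ->
    exists u : Hom X L, forall v, p v ∘ u = q v.

Definition has_finite_limits (C : category) : Prop :=
  forall D : finite_diagram C,
    exists (L : C) (p : forall v, Hom L (dob D v)), is_limit p.

Definition has_weak_finite_limits (C : category) : Prop :=
  forall D : finite_diagram C,
    exists (L : C) (p : forall v, Hom L (dob D v)), is_weak_limit p.

Definition is_product (C : category) (I : Type) (F : I -> C) (X : C)
    (p : forall i, Hom X (F i)) : Prop :=
  forall (Y : C) (q : forall i, Hom Y (F i)),
    exists! u : Hom Y X, forall i, p i ∘ u = q i.

Definition is_pullback (C : category) (X Y Z W : C)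
    (f : Hom X Z) (g : Hom Y Z) (p : Hom W X) (q : Hom W Y) : Prop :=
  f ∘ p = g ∘ q /\
  forall (V : C) (x : Hom V X) (y : Hom V Y), f ∘ x = g ∘ y ->
    exists! u : Hom V W, p ∘ u = x /\ q ∘ u = y.

Definition is_kernel_pair (C : category) (X Y R : C)
    (f : Hom X Y) (p1 p2 : Hom R X) : Prop :=
  is_pullback f f p1 p2.

Definition is_coequalizer (C : category) (X Y Q : C)
    (f1 f2 : Hom X Y) (q : Hom Y Q) : Prop :=
  q ∘ f1 = q ∘ f2 /\
  forall (Z : C) (g : Hom Y Z), g ∘ f1 = g ∘ f2 ->
    exists! u : Hom Q Z, u ∘ q = g.

Definition monomorphism (C : category) (X Y : C) (m : Hom X Y) : Prop :=
  forall (W : C) (a b : Hom W X), m ∘ a = m ∘ b -> a = b.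

Definition regular_epi (C : category) (X Y : C) (f : Hom X Y) : Prop :=
  exists (W : C) (a b : Hom W X), is_coequalizer a b f.

Definition regular (C : category) : Prop :=
  [/\ has_finite_limits C,
      forall (X Y R : C) (f : Hom X Y) (p1 p2 : Hom R X),
        is_kernel_pair f p1 p2 ->
        exists (Q : C) (q : Hom X Q), is_coequalizer p1 p2 q
    & forall (X Y Z W : C) (f : Hom X Z) (g : Hom Y Z)
        (p : Hom W X) (q : Hom W Y),
        is_pullback f g p q -> regular_epi f -> regular_epi q].

Record ideal (C : category) := Ideal {
  null : forall X Y : C, Hom X Y -> Prop;
  null_comp : forall (W X Y Z : C) (h : Hom W X) (g : Hom X Y) (f : Hom Y Z),
    null g -> null (f ∘ g ∘ h)
}.

Arguments null {C} M {X Y} f : rename.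

Definition restrict_ideal (C : category) (N : ideal C) (P : C -> Prop) :
    ideal (full_subcategory P) :=
  @Ideal (full_subcategory P) (fun X Y f => @null C N (sval X) (sval Y) f)
    (fun W X Y Z h g f => @null_comp C N _ _ _ _ h g f).

Definition is_ker (C : category) (M : ideal C) (X Y K : C)
    (f : Hom X Y) (k : Hom K X) : Prop :=
  null M (f ∘ k) /\
  forall (K' : C) (k' : Hom K' X), null M (f ∘ k') ->
    exists! u : Hom K' K, k' = k ∘ u.

Definition is_weak_ker (C : category) (M : ideal C) (X Y K : C)
    (f : Hom X Y) (k : Hom K X) : Prop :=
  null M (f ∘ k) /\
  forall (K' : C) (k' : Hom K' X), null M (f ∘ k') ->
    exists u : Hom K' K, k' = k ∘ u.

Definition has_kers (C : category) (M : ideal C) : Prop :=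
  forall (X Y : C) (f : Hom X Y), exists (K : C) (k : Hom K X), is_ker M f k.

Definition is_star (C : category) (M : ideal C) (X Y K : C)
    (f1 f2 : Hom X Y) (s1 s2 : Hom K Y) : Prop :=
  exists k : Hom K X, [/\ is_ker M f1 k, s1 = f1 ∘ k & s2 = f2 ∘ k].

Definition is_weak_star (C : category) (M : ideal C) (X Y K : C)
    (f1 f2 : Hom X Y) (s1 s2 : Hom K Y) : Prop :=
  exists k : Hom K X, [/\ is_weak_ker M f1 k, s1 = f1 ∘ k & s2 = f2 ∘ k].

Definition is_kernel_star (C : category) (M : ideal C) (X Y K : C)
    (f : Hom X Y) (s1 s2 : Hom K X) : Prop :=
  exists (R : C) (p1 p2 : Hom R X),
    is_kernel_pair f p1 p2 /\ is_star M p1 p2 s1 s2.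

(* Any two weak stars of the same pair factor through each other, so as soon as
   one exists it does not matter whether one or all of them are considered. In
   a projective cover of a category with kernels, weak kernels always exist:
   cover the kernel by a projective. *)
Definition star_pi0 (C : category) (M : ideal C) (X Y : C)
    (f1 f2 : Hom X Y) : Prop :=
  forall (K : C) (s1 s2 : Hom K Y), is_weak_star M f1 f2 s1 s2 ->
    forall (Z : C) (g : Hom Y Z), g ∘ s1 = g ∘ s2 <-> g ∘ f1 = g ∘ f2.

Record reflexive_graph (C : category) := ReflexiveGraph {
  graph1 : C;
  graph0 : C;
  graph_d : Hom graph1 graph0;
  graph_c : Hom graph1 graph0;
  graph_e : Hom graph0 graph1;
  graph_de : graph_d ∘ graph_e = idm graph0;
  graph_ce : graph_c ∘ graph_e = idm graph0
}.

Definition graph_star_pi0 (C : category) (M : ideal C)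
    (G : reflexive_graph C) : Prop :=
  star_pi0 M (graph_d G) (graph_c G).

(* Kernel stars exist under the first two clauses and are unique up to
   isomorphism, so quantifying over all of them loses nothing. *)
Definition star_regular (C : category) (N : ideal C) : Prop :=
  [/\ regular C,
      has_kers N
    & forall (X Y K : C) (f : Hom X Y) (s1 s2 : Hom K X),
        regular_epi f -> is_kernel_star N f s1 s2 -> is_coequalizer s1 s2 f].

Definition projective (C : category) (A : C) : Prop :=
  forall (X Y : C) (f : Hom X Y), regular_epi f ->
    @regular_epi SET (Hom A X) (Hom A Y) (fun h => f ∘ h).

(* The covering full subcategory is given by its class of objects P. *)
Definition projective_cover (C : category) (P : C -> Prop) : Prop :=
  (forall A : C, P A -> projective A) /\
  (forall X : C, exists (A : C) (f : Hom A X), P A /\ regular_epi f).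

Definition regular_completion (C : category) (P : C -> Prop) : Prop :=
  [/\ regular C,
      has_weak_finite_limits (full_subcategory P),
      projective_cover P
    & forall X : C,
        exists (n : nat) (F : 'I_n -> C) (A : C) (p : forall i, Hom A (F i))
               (m : Hom X A),
          [/\ forall i, P (F i), is_product p & monomorphism m]].

(* Main.v *)
From Stdlib Require Import FunctionalExtensionality PropExtensionality.
From mathcomp Require Import all_boot.
Require Import Defs.

Set Implicit Arguments.
Unset Strict Implicit.
Unset Printing Implicit Defensive.

Local Open Scope cat_scope.

(** From star-regularity to the condition on graphs: let [(d, c, e)] be a
    reflexive graph in [P] and let [g] equalize a weak star of [(d, c)].  The
    split epimorphism [d] is the coequalizer of its kernel star [(s1, s2)].
    Here [s1] is null, and [d s1 = d s2], so both [d s1] and [d s2] are null;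
    therefore, up to a projective cover of their domain, [s1] and [s2] factor
    through the weak kernel of [d], where [g d] and [g c] agree.  It follows
    that [g c s1 = g d s1 = g d s2 = g c s2], so [g c = h d] for some [h], and
    composing with [e] gives [h = g].

    Conversely, let [f : X -> Y] be a regular epimorphism with kernel pair
    [(p1, p2)], and let [g : X -> Z] equalize its kernel star.  As [f] is the
    coequalizer of [(p1, p2)], it suffices that [g p1 = g p2].  A projective
    cover [q : A -> X] lets one present [(p1, p2)] by a reflexive graph [(d, c)]
    on [A] in [P] ([projective_graph_over_kernel_pair]): a projective cover of
    the inverse image of the kernel pair along [q], whose reflexivity lifts to
    the cover because [A] is projective.  A weak star of [(d, c)] becomes, after
    composition with [q], a pair factoring through the kernel star of [f], so
    [g q] equalizes it.  The condition on graphs only tests morphisms into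
    objects of [P], and this is where the embedding of [Z] into a finite product
    of such objects enters: each component of [g q] satisfies the condition, so
    [g q d = g q c], and [g p1 = g p2] follows by cancelling an epimorphism. *)

(** * Regular epimorphisms, pullbacks and projective objects *)

Lemma regular_epi_epi (C : category) (X Y Z : C) (f : Hom X Y) (a b : Hom Y Z) :
  regular_epi f -> a ∘ f = b ∘ f -> a = b.
Proof.
move=> [W [s [t [fst univ]]]] E.
have Eb : (b ∘ f) ∘ s = (b ∘ f) ∘ t by rewrite -!comp_assoc fst.
have [u [_ uniq]] := univ Z (b ∘ f) Eb.
by rewrite -(uniq a E) -(uniq b erefl).
Qed.

(** A regular epimorphism is the coequalizer of its kernel pair, because the
    pair it was a coequalizer of factors through the kernel pair. *)
Lemma regular_epi_factor (C : category) (X Y Z R : C) (f : Hom X Y)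
    (p1 p2 : Hom R X) (g : Hom X Z) :
  regular_epi f -> is_kernel_pair f p1 p2 -> g ∘ p1 = g ∘ p2 ->
  exists! u : Hom Y Z, u ∘ f = g.
Proof.
move=> [W [s [t [fst univ]]]] [_ pb] E; apply: univ.
have [u [[<- <-] _]] := pb _ _ _ fst.
by rewrite !comp_assoc E.
Qed.

Lemma split_epi_regular (C : category) (X Y : C) (d : Hom X Y) (e : Hom Y X) :
  d ∘ e = idm Y -> regular_epi d.
Proof.
move=> de; exists X, (e ∘ d), (idm X); split.
  by rewrite comp_assoc de comp_idl comp_idr.
move=> Z g; rewrite comp_idr => E; exists (g ∘ e); split.
  by rewrite -comp_assoc.
by move=> u <-; rewrite -comp_assoc de comp_idr.
Qed.

Definition cospan (C : category) (X Y Z : C) (f : Hom X Z) (g : Hom Y Z) :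
    finite_diagram C :=
  let ob (v : option bool) :=
    match v with Some true => X | Some false => Y | None => Z end in
  @FiniteDiagram C (option bool) bool Some (fun=> None) ob
    (fun e => match e return Hom (ob (Some e)) Z with true => f | false => g end).

Lemma pullback_exists (C : category) (X Y Z : C) (f : Hom X Z) (g : Hom Y Z) :
  has_finite_limits C ->
  exists (W : C) (p : Hom W X) (q : Hom W Y), is_pullback f g p q.
Proof.
move=> /(_ (cospan f g)) [L [p [cone univ]]].
exists L, (p (Some true)), (p (Some false)); split.
  by rewrite (cone true) (cone false).
move=> V x y E.
pose q (v : option bool) : Hom V (dob (cospan f g) v) :=
  match v with Some true => x | Some false => y | None => f ∘ x end.
have [|u [pu uniq]] := univ V q; first by case=> //=; rewrite -E.
exists u; split; first by split; [exact: (pu (Some true)) | exact: (pu (Some false))].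
move=> w [wx wy]; apply: uniq => -[[]|] //=.
by rewrite -(cone true) /= -comp_assoc wx.
Qed.

(** The subobject classifier of sets detects surjectivity: the predicate of
    being in the image and the constantly true one agree after composition with
    the map, and a regular epimorphism is right cancellable. *)
Lemma SET_regular_epi_surjective (X Y : SET) (f : Hom X Y) :
  regular_epi f -> forall y : Y, exists x : X, f x = y.
Proof.
move=> fr y.
pose im : @Hom SET Y Prop := fun y => exists x, f x = y.
pose tt : @Hom SET Y Prop := fun=> True.
have E : im = tt.
  apply: (regular_epi_epi fr); apply: functional_extensionality => x /=.
  by apply: propositional_extensionality; split=> // _; exists x.
by rewrite -/(im y) E.
Qed.

Lemma projective_lift (C : category) (A X Y : C) (f : Hom X Y) (y : Hom A Y) :
  projective A -> regular_epi f -> exists x : Hom A X, f ∘ x = y.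
Proof. by move=> pA /pA /SET_regular_epi_surjective /(_ y). Qed.

(** * Null morphisms and weak kernels *)

Lemma null_postcomp (C : category) (N : ideal C) (X Y Z : C) (g : Hom X Y)
    (f : Hom Y Z) : null N g -> null N (f ∘ g).
Proof. by move=> /(null_comp (idm X) f); rewrite comp_idr. Qed.

Lemma null_precomp (C : category) (N : ideal C) (W X Y : C) (g : Hom X Y)
    (h : Hom W X) : null N g -> null N (g ∘ h).
Proof. by move=> /(null_comp h (idm Y)); rewrite comp_idl. Qed.

(** A projective cover of a kernel is a weak kernel in the subcategory. *)
Lemma weak_ker_exists (C : category) (N : ideal C) (P : C -> Prop)
    (X Y : full_subcategory P) (f : Hom X Y) :
  has_kers N -> projective_cover P ->
  exists (K : full_subcategory P) (k : Hom K X),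
    is_weak_ker (restrict_ideal N P) f k.
Proof.
move=> hN [proj cover].
have [K [k [fk univ]]] := hN (sval X) (sval Y) f.
have [A [q [PA qr]]] := cover K.
exists (exist _ A PA), (k ∘ q); split=> /=.
  by rewrite comp_assoc; exact: null_precomp.
move=> [K' PK'] k' fk'.
have [u [-> _]] := univ K' k' fk'.
have [v <-] := projective_lift u (proj _ PK') qr.
by exists v; rewrite comp_assoc.
Qed.

(** The domain of [s] need not lie in [P], but over a projective cover of it [s]
    factors through [k], and the cover is an epimorphism. *)
Lemma weak_ker_test (C : category) (N : ideal C) (P : C -> Prop)
    (K X Y : full_subcategory P) (d : Hom X Y) (k : Hom K X)
    (S Z : C) (s : Hom S (sval X)) (a b : Hom (sval X) Z) :
  projective_cover P -> is_weak_ker (restrict_ideal N P) d k ->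
  @comp C _ _ _ a k = @comp C _ _ _ b k -> null N (@comp C _ _ _ d s) ->
  a ∘ s = b ∘ s.
Proof.
move=> [_ cover] [_ wk] E ds.
have [A [q [PA qr]]] := cover S.
apply: (regular_epi_epi qr).
have [|u /= su] := wk (exist _ A PA) (s ∘ q).
  by rewrite /= comp_assoc; exact: null_precomp.
by rewrite -!comp_assoc su !comp_assoc E.
Qed.

(** * From star-regularity to reflexive graphs *)

Lemma star_regular_graph_star_pi0 (C : category) (N : ideal C) (P : C -> Prop)
    (G : reflexive_graph (full_subcategory P)) :
  projective_cover P -> star_regular N ->
  graph_star_pi0 (restrict_ideal N P) G.
Proof.
move=> hP [[lim _ _] hN star]; case: G => G1 G0 d c e de ce.
move=> K s1 s2 /= [k [wk -> ->]] Z g; rewrite !comp_assoc.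
split=> [E|-> //].
have [R [p1 [p2 kp]]] := @pullback_exists C _ _ _ d d lim.
have [S [t [ts tuniv]]] := hN _ _ p1.
have [|_ coeq] := star _ _ _ d (p1 ∘ t) (p2 ∘ t) (split_epi_regular (C := C) de).
  by exists R, p1, p2; split=> //; exists t.
have dt : @comp C _ _ _ d (p1 ∘ t) = @comp C _ _ _ d (p2 ∘ t).
  by rewrite !comp_assoc (proj1 kp).
have dt0 : null N (@comp C _ _ _ d (p1 ∘ t)) by exact: null_postcomp.
have E1 := weak_ker_test hP wk E dt0.
rewrite dt in dt0.
have E2 := weak_ker_test hP wk E dt0.
have [|h [hd _]] := coeq _ (@comp C _ _ _ g c).
  by rewrite -E1 -E2 -!(@comp_assoc C) dt.
have hg : h = g.
  rewrite -(comp_idr h) -[RHS](@comp_idr C).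
  by rewrite -[X in h ∘ X]de -[X in @comp C _ _ _ g X]ce /= !comp_assoc hd.
by rewrite /= -hd hg.
Qed.

(** * From reflexive graphs to star-regularity *)

(** The graph is a projective cover of the inverse image along [q] of the
    kernel pair; [w] is its comparison with the kernel pair, an epimorphism
    because regular epimorphisms are stable under pullback.  The inverse image
    is reached in two pullbacks, one for each projection, because stability
    then applies to each of them. *)
Lemma projective_graph_over_kernel_pair (C : category) (P : C -> Prop)
    (A : full_subcategory P) (X Y R : C) (f : Hom X Y) (p1 p2 : Hom R X)
    (q : Hom (sval A) X) :
  regular C -> projective_cover P -> is_kernel_pair f p1 p2 -> regular_epi q ->
  exists (G1 : full_subcategory P) (d c : Hom G1 A) (e : Hom A G1)
         (w : Hom (sval G1) R),
    [/\ d ∘ e = idm A /\ c ∘ e = idm A,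
        q ∘ d = p1 ∘ w, q ∘ c = p2 ∘ w
      & forall (Z : C) (a b : Hom R Z), a ∘ w = b ∘ w -> a = b].
Proof.
move=> [lim _ stable] [proj cover] [_ kp] qr.
have [W1 [a1 [w1 pb1]]] := pullback_exists q p1 lim.
have [W2 [a2 [w2 pb2]]] := pullback_exists q (p2 ∘ w1) lim.
have w1r := stable _ _ _ _ _ _ _ _ pb1 qr.
have w2r := stable _ _ _ _ _ _ _ _ pb2 qr.
have [B [b [PB br]]] := cover W2.
case: pb1 => sq1 univ1; case: pb2 => sq2 univ2.
(* The diagonal of A, as a section over R, then over W1, then over W2. *)
have [delta [[p1d p2d] _]] := kp _ q q erefl.
have [|alpha [[a1a w1a] _]] := univ1 _ (idm (sval A)) delta.
  by rewrite comp_idr p1d.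
have [|beta [[a2b w2b] _]] := univ2 _ (idm (sval A)) alpha.
  by rewrite comp_idr -comp_assoc w1a p2d.
have [e be] := projective_lift beta (proj _ (svalP A)) br.
exists (exist _ B PB), (a1 ∘ w2 ∘ b), (a2 ∘ b), e, (w1 ∘ w2 ∘ b); split=> /=.
- by rewrite -!comp_assoc be w2b a1a a2b.
- by rewrite !comp_assoc sq1.
- by rewrite !comp_assoc sq2.
move=> Z x y; rewrite !comp_assoc => E.
by apply: (regular_epi_epi w1r); apply: (regular_epi_epi w2r);
  apply: (regular_epi_epi br).
Qed.

Lemma product_jointly_monic (C : category) (I : Type) (F : I -> C) (X Y : C)
    (p : forall i, Hom X (F i)) (a b : Hom Y X) :
  is_product p -> (forall i, p i ∘ a = p i ∘ b) -> a = b.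
Proof.
move=> prod E; have [u [_ uniq]] := prod Y (fun i => p i ∘ b).
by rewrite -(uniq a E) -(uniq b (fun=> erefl)).
Qed.

(** Objects of [P] cogenerate a regular completion well enough to test the
    condition on graphs against morphisms into arbitrary objects. *)
Lemma graph_star_pi0_ambient (C : category) (N : ideal C) (P : C -> Prop)
    (K : full_subcategory P) (G : reflexive_graph (full_subcategory P))
    (k : Hom K (graph1 G)) (Z : C) (g : Hom (sval (graph0 G)) Z) :
  regular_completion P -> graph_star_pi0 (restrict_ideal N P) G ->
  is_weak_ker (restrict_ideal N P) (graph_d G) k ->
  @comp C _ _ _ g (graph_d G ∘ k) = @comp C _ _ _ g (graph_c G ∘ k) ->
  @comp C _ _ _ g (graph_d G) = @comp C _ _ _ g (graph_c G).
Proof.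
move=> [_ _ _ /(_ Z) [n [F [A [p [m [PF prod mono]]]]]]] pi0 wk E.
apply: mono; apply: (product_jointly_monic prod) => i.
have ws : is_weak_star (restrict_ideal N P) (graph_d G) (graph_c G)
    (graph_d G ∘ k) (graph_c G ∘ k) by exists k.
have [pi0i _] := pi0 _ _ _ ws (exist _ (F i) (PF i)) (p i ∘ m ∘ g).
by move: pi0i; rewrite /= -!(@comp_assoc C) => -> //; congr (_ ∘ (_ ∘ _)).
Qed.

(** The pair [(q d k, q c k)], with [k] annihilated by [d], factors through the
    kernel star of [f]. *)
Lemma graph_star_pi0_star_regular (C : category) (N : ideal C) (P : C -> Prop) :
  has_kers N -> regular_completion P ->
  (forall G : reflexive_graph (full_subcategory P),
     graph_star_pi0 (restrict_ideal N P) G) ->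
  star_regular N.
Proof.
move=> hN rc pi0; have [hC _ hP _] := rc; split=> //.
move=> X Y S f _ _ fr [R [p1 [p2 [kp [t [[tN tuniv] -> ->]]]]]].
split; first by rewrite !comp_assoc (proj1 kp).
move=> Z g; rewrite !comp_assoc => gt; apply: (regular_epi_factor fr kp).
have [A [q [PA qr]]] := proj2 hP X.
have [G1 [d [c [e [w [[de ce] qd qc epi]]]]]] :=
  @projective_graph_over_kernel_pair C P (exist _ A PA) _ _ _ _ _ _ q hC hP kp qr.
apply: epi; rewrite -!comp_assoc -qd -qc !comp_assoc.
have [K [k wk]] := weak_ker_exists d hN hP.
pose G := ReflexiveGraph de ce.
apply: (@graph_star_pi0_ambient C N P K G k Z (g ∘ q) rc (pi0 G) wk) => /=.
have [|v [wv _]] := tuniv _ (w ∘ k).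
  by rewrite comp_assoc -qd -comp_assoc; apply: null_postcomp; case: wk.
have qdk : q ∘ @comp C _ _ _ d k = p1 ∘ t ∘ v.
  by rewrite comp_assoc qd -!comp_assoc wv.
have qck : q ∘ @comp C _ _ _ c k = p2 ∘ t ∘ v.
  by rewrite comp_assoc qc -!comp_assoc wv.
by rewrite -[LHS](@comp_assoc C) -[RHS](@comp_assoc C) qdk qck !comp_assoc gt.
Qed.

Theorem theorem3p3 (C : category) (N : ideal C) (P : C -> Prop)
    (hC : regular C) (hN : has_kers N) (hP : projective_cover P) :
  (star_regular N ->
     forall G : reflexive_graph (full_subcategory P),
       graph_star_pi0 (restrict_ideal N P) G) /\
  (regular_completion P ->
     (forall G : reflexive_graph (full_subcategory P),
        graph_star_pi0 (restrict_ideal N P) G) ->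
     star_regular N).
Proof.
split; first by move=> sr G; exact: star_regular_graph_star_pi0.
exact: graph_star_pi0_star_regular.
Qed.
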